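(* Let $d,m\ge 1$ be integers, and let $g,h:[0,\infty)\to\mathbb{R}$ be two nondecreasing convex functions such that $h(0)=0$. If $A_1,\ldots,A_m\in\mathbb{M}_d^+$, then there exist unitary matrices $V_1,\ldots,V_d\in\mathbb{M}_d$ such that $$ g\left(\sum_{k=1}^m h(A_k)\right)\le \frac{1}{d}\sum_{i=1}^d V_i\left\{(g\circ h)\left(\sum_{k=1}^m A_k\right)\right\}V_i^*. $$
   Context: $\mathbb{M}_d$ is the space of complex $d\times d$ matrices and $\mathbb{M}_d^+$ its cone of positive semidefinite matrices. Functions of Hermitian matrices are defined by the usual spectral functional calculus. The inequality $X\le Y$ between Hermitian matrices is the usual (Loewner) order: $Y-X\in\mathbb{M}_d^+$. *)

(* Defs.v *)
From HB Require Import structures.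
From mathcomp Require Import all_boot all_order all_algebra.
From mathcomp Require Import complex.
From mathcomp Require Import classical_sets reals convex.

Set Implicit Arguments.
Unset Strict Implicit.
Unset Printing Implicit Defensive.

Import Order.TTheory GRing.Theory Num.Theory.
Local Open Scope ring_scope.
Local Open Scope complex_scope.
Local Open Scope sesquilinear_scope.

Definition psdmx (R : rcfType) (d : nat) (A : 'M[R[i]]_d) : Prop :=
  A \is hermsymmx /\ forall v : 'cV[R[i]]_d, 0 <= (v^t* *m A *m v) 0 0.

Definition loewner_le (R : rcfType) (d : nat) (A B : 'M[R[i]]_d) : Prop :=
  psdmx (B - A).

(* The library diagonalizes a normal A as P^t* *m diag_mx D *m P with P unitary,
   P = spectralmx A and D = spectral_diag A; for Hermitian A the entries of D
   are real, so nothing is lost by taking real parts. The value does not depend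
   on the chosen diagonalization (mxfun_diag below); it is meaningful only for
   Hermitian A. *)
Definition mxfun (R : rcfType) (d : nat) (f : R -> R) (A : 'M[R[i]]_d) :
    'M[R[i]]_d :=
  (spectralmx A)^t*
    *m diag_mx (map_mx (fun z => (f (complex.Re z))%:C) (spectral_diag A))
    *m spectralmx A.

Lemma mxfun_diag (R : rcfType) (d : nat) (f : R -> R) (U : 'M[R[i]]_d)
    (D : 'rV[R]_d) : U \is unitarymx ->
  mxfun f (U^t* *m diag_mx (map_mx (fun x => x%:C) D) *m U)
    = U^t* *m diag_mx (map_mx (fun x => (f x)%:C) D) *m U.
Proof.
move=> Uu; rewrite /mxfun; set A := (X in spectralmx X).
set P := spectralmx A; set S := spectral_diag A.
have Pu : P \is unitarymx by exact: spectral_unitarymx.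
have U1 : U *m U^t* = 1%:M by exact/unitarymxP.
have P1 : P *m P^t* = 1%:M by exact/unitarymxP.
have U2 : U^t* *m U = 1%:M by exact: mulmx1C.
have P2 : P^t* *m P = 1%:M by exact: mulmx1C.
have trD (E : 'rV[R]_d) : (diag_mx (map_mx (fun x => x%:C) E))^t* =
    diag_mx (map_mx (fun x => x%:C) E).
  apply/matrixP=> i j; rewrite !mxE eq_sym rmorphMn /=.
  case: eqP => [->|_]; last by rewrite !mulr0n.
  by rewrite !mulr1n; congr (_ +i* _); rewrite oppr0.
have An : A \is normalmx.
  have Ah : A^t* = A.
    by rewrite /A !trmx_mul !map_mxM trmxCK mulmxA trD.
  by apply/normalmxP; rewrite Ah.
have AE : A = P^t* *m diag_mx S *m P.
  by rewrite -(invmx_unitary Pu); exact/orthomx_spectralP.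
have [W defW] : exists W, W = P *m U^t* by exists (P *m U^t*).
have WE : W *m diag_mx (map_mx (fun x => x%:C) D) = diag_mx S *m W.
  have E : P *m A *m U^t* = P *m (P^t* *m diag_mx S *m P) *m U^t*.
    by rewrite -AE.
  move: E; rewrite [in P *m A]/A !mulmxA P1 mul1mx.
  by rewrite -[_ *m U *m U^t*]mulmxA U1 mulmx1 defW mulmxA.
have WfE : W *m diag_mx (map_mx (fun x => (f x)%:C) D) =
    diag_mx (map_mx (fun z => (f (complex.Re z))%:C) S) *m W.
  apply/matrixP=> i j; move/matrixP/(_ i j): WE.
  rewrite !mul_mx_diag !mul_diag_mx !mxE.
  have [->|W0] := eqVneq (W i j) 0; first by rewrite !mulr0 !mul0r.
  by rewrite mulrC => /(mulIf W0) <-; rewrite /= mulrC.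
have -> : U^t* = P^t* *m W by rewrite defW mulmxA P2 mul1mx.
rewrite -[P^t* *m W *m _]mulmxA WfE -!mulmxA; congr (_ *m (_ *m _)).
by rewrite defW -mulmxA U2 mulmx1.
Qed.

(* Main.v *)
Require Import Defs.
From HB Require Import structures.
From mathcomp Require Import all_boot all_order all_algebra.
From mathcomp Require Import complex.
From mathcomp Require Import classical_sets reals convex.
From mathcomp Require Import fingroup perm cyclic separable cyclotomic.
From mathcomp Require Import boolp interval_inference lra ring zify.

Set Implicit Arguments.
Unset Strict Implicit.
Unset Printing Implicit Defensive.

Import Order.TTheory GRing.Theory Num.Theory.
Local Open Scope ring_scope.
Local Open Scope complex_scope.
Local Open Scope sesquilinear_scope.

(** Write [S] for the sum of the [A_k] and [B] for the sum of the [h(A_k)], with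
    nonincreasing eigenvalues [mu] and [beta], and let [e_i] be an eigenbasis of [B].
    Choose [t_i >= 0] with [h(t_i) = beta_i].  Splitting every [A_k] into rank-one
    pieces [alpha v v^*] with [v] a unit vector, and putting [b = h(alpha)] and
    [w_i = |<e_i, v>|^2], the inequality [b v v^* <= B] means that the weights
    [b w_i / beta_i] have sum at most 1, so that
    [h(sum_i (b w_i / beta_i) t_i) <= sum_i b w_i = h(alpha)], hence
    [sum_i (b w_i / beta_i) t_i <= alpha].  As [t_i / beta_i] is nondecreasing in
    [i], this persists for truncated sums:
    [sum_(i < k) (b w_i / beta_i) t_i <= sum_(i < k) alpha w_i].
    Summing over all pieces, [sum_(i < k) t_i <= sum_(i < k) <S e_i, e_i>], and by
    Ky Fan's principle [t] is weakly majorized by [mu].  Horn's theorem provides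
    an orthogonal [O] with [t_i <= sum_j O_ij^2 mu_j], and Jensen's inequality for the
    nondecreasing convex function [g o h] bounds [g(beta_i)] by the diagonal of
    [O diag(g(h(mu))) O^T].  That diagonal is the average of [d] unitary conjugates,
    by diagonal matrices of powers of a primitive [d]-th root of unity. *)

(** * Convex functions on the nonnegative half-line *)

Section NonnegativeConvex.
Variable R : realType.
Implicit Types (f h : R -> R) (x y t : R).

Definition nneg_convex f := forall x y t, 0 <= x -> 0 <= y -> 0 <= t <= 1 ->
  f (t * x + (1 - t) * y) <= t * f x + (1 - t) * f y.

Lemma convex_function_nneg f :
  @convex_function R R^o [set x : R | 0 <= x]%classic f -> nneg_convex f.
Proof.
move=> fC x y t x0 y0 /andP[t0 t1].
by apply: (fC (Itv01 t0 t1) x y); rewrite in_setE.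
Qed.

(** The pair [q], [c] accumulates the mass and the barycentre of the points already absorbed. Each
    induction step merges one more point into it by two-point convexity; if the merged mass is zero,
    the barycentre is irrelevant and is reset to [0]. *)
Lemma convex_combination I (r : seq I) f (p s : I -> R) q c :
  nneg_convex f -> (forall i, 0 <= p i) -> (forall i, 0 <= s i) ->
  0 <= q -> 0 <= c -> q + \sum_(i <- r) p i = 1 ->
  f (q * c + \sum_(i <- r) p i * s i) <= q * f c + \sum_(i <- r) p i * f (s i).
Proof.
move=> fC p0 s0; elim: r q c => [|i r IH] q c q0 c0.
  by rewrite !big_nil !addr0 => ->; rewrite !mul1r.
rewrite !big_cons !addrA => E.
have q'0 : 0 <= q + p i by rewrite addr_ge0.
have [z|nz] := eqVneq (q + p i) 0.
  have q_0 : q = 0 by move: (p0 i); lra.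
  have pi0 : p i = 0 by move: (p0 i); lra.
  have := IH 0 c (lexx _) c0; rewrite q_0 pi0 !mul0r !add0r; apply.
  by move: E; rewrite q_0 pi0 !add0r.
have q'1 : 0 < q + p i by rewrite lt0r nz.
pose c' := (q * c + p i * s i) / (q + p i).
have c'0 : 0 <= c' by rewrite divr_ge0 // addr_ge0 // mulr_ge0.
have <- : (q + p i) * c' = q * c + p i * s i by rewrite /c'; field.
apply: le_trans (IH _ _ q'0 c'0 E) _; rewrite lerD2r.
have t01 : 0 <= q / (q + p i) <= 1.
  by rewrite divr_ge0 //= ler_pdivrMr // mul1r lerDl.
have := fC _ _ _ c0 (s0 i) t01.
have -> : q / (q + p i) * c + (1 - q / (q + p i)) * s i = c'.
  by rewrite /c'; field.
have -> : q / (q + p i) * f c + (1 - q / (q + p i)) * f (s i) =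
    (q * f c + p i * f (s i)) / (q + p i) by field.
by rewrite ler_pdivlMr // mulrC.
Qed.

Lemma jensen (I : finType) f (p s : I -> R) :
  nneg_convex f -> (forall i, 0 <= p i) -> (forall i, 0 <= s i) ->
  \sum_i p i = 1 -> f (\sum_i p i * s i) <= \sum_i p i * f (s i).
Proof.
move=> fC p0 s0 p1; have := convex_combination (r := index_enum I) fC p0 s0
  (lexx 0) (lexx 0).
by rewrite !mul0r !add0r; exact.
Qed.

Variable h : R -> R.
Hypotheses (hC : nneg_convex h) (h0 : h 0 = 0).

(** The missing mass [1 - \sum_i p i] is placed at [0], where [h] vanishes. *)
Lemma jensen_sub (I : finType) (p s : I -> R) :
  (forall i, 0 <= p i) -> (forall i, 0 <= s i) -> \sum_i p i <= 1 ->
  h (\sum_i p i * s i) <= \sum_i p i * h (s i).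
Proof.
move=> p0 s0 p1.
have q0 : 0 <= 1 - \sum_i p i by rewrite subr_ge0.
have := convex_combination (r := index_enum I) hC p0 s0 q0 (lexx 0) (subrK _ _).
by rewrite h0 !mulr0 !add0r.
Qed.

Lemma convex_scale c x : 0 <= x -> 0 <= c <= 1 -> h (c * x) <= c * h x.
Proof. by move=> x0 /(hC x0 (lexx 0)); rewrite h0 !mulr0 !addr0. Qed.

(** If [x < y], then [h x <= (x / y) * h y <= (x / y) * h x < h x], a contradiction. *)
Lemma convex_le_inv x y :
  0 <= x -> 0 <= y -> 0 < h x -> h y <= h x -> y <= x.
Proof.
move=> x0 y0 hx hyx; rewrite leNgt; apply/negP=> xy.
have yp : 0 < y by exact: le_lt_trans xy.
have xy1 : x / y < 1 by rewrite ltr_pdivrMr // mul1r.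
have xy0 : 0 <= x / y by rewrite divr_ge0.
have := @convex_scale (x / y) y y0; rewrite xy0 (ltW xy1) => /(_ isT).
rewrite mulfVK ?gt_eqF // => H.
have : x / y * h y <= x / y * h x by rewrite ler_wpM2l.
have : x / y * h x < h x by rewrite gtr_pMl.
by lra.
Qed.

Hypothesis h_ndecr : {in `[0, +oo[ &, {homo h : x y / x <= y}}.

Lemma nneg_ndecr x y : 0 <= x -> x <= y -> h x <= h y.
Proof.
by move=> x0 xy; apply: h_ndecr; rewrite // in_itv /= andbT //; exact: le_trans xy.
Qed.

(** An intermediate value argument in which convexity replaces continuity: [t] is the supremum of
    the points where [h] is at most [b]. *)
Lemma nneg_convex_surj a b :
  0 <= a -> 0 < h a -> 0 <= b -> exists2 t, 0 <= t & h t = b.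
Proof.
move=> a0 ha b0.
pose A := [set x : R | 0 <= x /\ h x <= b]%classic.
have A0 : A 0 by split; rewrite // h0.
(* Convexity makes [h] grow at least linearly beyond [a]: its value at this bound is at least
   [h a + b > b]. *)
have Aub : ubound A ((1 + b / h a) * a).
  move=> x [x0 hx]; rewrite leNgt; apply/negP=> lt_x.
  have c0 : 0 < 1 + b / h a by rewrite ltr_wpDr // divr_ge0 // ltW.
  have ca0 : 0 <= (1 + b / h a) * a by rewrite mulr_ge0 // ltW.
  have := @convex_scale (1 + b / h a)^-1 _ ca0.
  rewrite invr_ge0 (ltW c0) invf_le1 // lerDl divr_ge0 ?(ltW ha) // => /(_ isT).
  rewrite mulKf ?gt_eqF // ler_pdivlMl // mulrDl mul1r mulfVK ?gt_eqF //.
  by have := nneg_ndecr ca0 (ltW lt_x); lra.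
have hsA : has_sup A by split; [exists 0 | exists ((1 + b / h a) * a)].
pose t := sup A.
have t0 : 0 <= t by apply: ub_le_sup A0; case: hsA.
have t10 : 0 <= t + 1 by lra.
have H : h t <= h (t + 1) by apply: nneg_ndecr => //; lra.
exists t => //; apply/eqP; rewrite eq_le; apply/andP; split; rewrite leNgt; apply/negP=> hb.
  (* Case [b < h t]: a point [x] of [A] closer than [e] to [t] violates convexity on [x], [t],
     [t + 1]. The added [1] keeps the denominator positive when [h] is constant on [[t, t + 1]]. *)
  pose e := (h t - b) / (1 + (h (t + 1) - h t)).
  have D0 : 0 < 1 + (h (t + 1) - h t) by lra.
  have e0 : 0 < e by rewrite divr_gt0 // subr_gt0.
  have [x [x0 hx] xt] := sup_adherent e0 hsA.
  have xt' : x <= t by apply: ub_le_sup; [case: hsA | split].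
  pose u := t - x.
  have u0 : 0 <= u by rewrite subr_ge0.
  have ue : u * (1 + (h (t + 1) - h t)) < h t - b.
    by rewrite -ltr_pdivlMr // -/e /u; move: xt; rewrite -/t; lra.
  have v0 : 0 < 1 + u by lra.
  have := @hC x (t + 1) (1 + u)^-1 x0 t10.
  rewrite invr_ge0 (ltW v0) invf_le1 // lerDl u0 => /(_ isT).
  have -> : (1 + u)^-1 * x + (1 - (1 + u)^-1) * (t + 1) = t.
    by rewrite /u; field; rewrite -/u gt_eqF.
  have -> : (1 + u)^-1 * h x + (1 - (1 + u)^-1) * h (t + 1) =
     (h x + u * h (t + 1)) / (1 + u) by field; rewrite gt_eqF.
  by rewrite ler_pdivlMr //; lra.
(* Case [h t < b]: the chord from [t] to [t + 1] stays at most [b] up to [t + e], so [t + e] lies in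
   [A], beyond its supremum. *)
pose D := b - h t + (h (t + 1) - h t).
have D0 : 0 < D by rewrite /D; lra.
pose e := (b - h t) / D.
have e0 : 0 < e by rewrite divr_gt0 // subr_gt0.
have e1 : e <= 1 by rewrite ler_pdivrMr // mul1r /D; lra.
have eH : e * (h (t + 1) - h t) <= b - h t.
  rewrite /e mulrAC ler_pdivrMr // ler_wpM2l ?subr_ge0 ?(ltW hb) // /D; lra.
have : t + e <= t.
  apply: ub_le_sup; first by case: hsA.
  split; first by lra.
  have := @hC (t + 1) t e t10 t0; rewrite (ltW e0) e1 => /(_ isT).
  have -> : e * (t + 1) + (1 - e) * t = t + e by ring.
  by lra.
by lra.
Qed.

End NonnegativeConvex.

(** * Truncated sums of the preimages [t i] *)

Section PartialSums.
Variables (R : realType) (h : R -> R) (d : nat) (beta t : nat -> R).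
Hypotheses (hC : nneg_convex h) (h0 : h 0 = 0).
Hypothesis beta_nincr : forall i j, (i <= j < d)%N -> beta j <= beta i.
Hypothesis beta_ge0 : forall i, (i < d)%N -> 0 <= beta i.
Hypothesis t_ge0 : forall i, 0 <= t i.
Hypothesis ht : forall i, (i < d)%N -> h (t i) = beta i.
Hypothesis t_eq0 : forall i, (i < d)%N -> beta i = 0 -> t i = 0.

(* Division by [beta i = 0] gives [0]; this is harmless, since then [h a * w i = 0]
   and [t i = 0]. *)
Lemma partial_sum_weight (k : nat) (a : R) (w : 'I_d -> R) :
  0 <= a -> 0 <= h a -> (forall i, 0 <= w i) -> \sum_i w i = 1 ->
  (forall i : 'I_d, beta i = 0 -> h a * w i = 0) ->
  h a * (\sum_(i < d) w i / beta i) <= 1 ->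
  \sum_(i < d | (i < k)%N) h a * w i * (t i / beta i) <=
    \sum_(i < d | (i < k)%N) a * w i.
Proof.
move=> a0; rewrite le_eqVlt => /orP[/eqP <- w0 _ _ _|ha w0 w1 wz wb].
  by apply: ler_sum => i _; rewrite !mul0r mulr_ge0.
have wz' (i : 'I_d) : beta i = 0 -> w i = 0.
  by move=> /wz /eqP; rewrite mulf_eq0 (gt_eqF ha) => /eqP.
have bpos (i : 'I_d) : beta i != 0 -> 0 < beta i by move=> bi; rewrite lt0r bi beta_ge0.
(* The ratio of preimage to value decreases as the value grows, so the terms compare one way when
   [h a <= beta i] and the other way when [beta i < h a]. *)
have low (i : 'I_d) : h a <= beta i -> h a * w i * (t i / beta i) <= a * w i.
  move=> hb; have bi : 0 < beta i by exact: lt_le_trans hb.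
  rewrite (mulrAC (h a)) ler_wpM2r //.
  have -> : h a * (t i / beta i) = h a / beta i * t i by ring.
  have c01 : 0 <= h a / beta i <= 1.
    by rewrite divr_ge0 ?(ltW ha) ?(ltW bi) //= ler_pdivrMr // mul1r.
  apply: (convex_le_inv hC h0) => //.
    by rewrite mulr_ge0 // divr_ge0 // ltW.
  by apply: le_trans (convex_scale hC h0 _ c01) _; rewrite // ht // mulfVK ?gt_eqF.
have high (i : 'I_d) : beta i < h a -> a * w i <= h a * w i * (t i / beta i).
  have [/wz' ->|bi hb] := eqVneq (beta i) 0; first by rewrite !mulr0 mul0r.
  have {}bi := bpos _ bi.
  rewrite (mulrAC (h a)) ler_wpM2r // mulrA ler_pdivlMr // mulrC.
  rewrite -ler_pdivrMl // mulrA.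
  have c01 : 0 <= (h a)^-1 * beta i <= 1.
    by rewrite mulr_ge0 ?invr_ge0 ?(ltW ha) ?(ltW bi) //= ler_pdivrMl // mulr1 ltW.
  apply: (convex_le_inv hC h0) => //.
  - by rewrite mulr_ge0 //; case/andP: c01.
  - by rewrite ht.
  apply: le_trans (convex_scale hC h0 _ c01) _; rewrite // ht //.
  by rewrite mulrAC mulVf ?mul1r // gt_eqF.
(* Either all indices below [k] compare termwise, or some [beta i0 < h a] with [i0 < k]. In the
   latter case every index from [k] on compares the other way, and this tail is subtracted from the
   inequality for the full sums. *)
case: (boolP [forall i : 'I_d, (i < k)%N ==> (h a <= beta i)]) => [/forallP H|].
  by apply: ler_sum => i ik; apply: low; have := H i; rewrite ik.
rewrite negb_forall => /existsP[i0]; rewrite negb_imply -ltNge => /andP[i0k bi0].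
(* By [jensen_sub], [h] of the left side is at most [\sum_i h a * w i = h a]; then [convex_le_inv]
   removes [h]. *)
have all_le : \sum_(i < d) h a * w i * (t i / beta i) <= \sum_(i < d) a * w i.
  rewrite -mulr_sumr w1 mulr1.
  rewrite (eq_bigr (fun i => h a * w i / beta i * t i)); last by move=> i _; rewrite mulrA mulrAC.
  have p0 (i : 'I_d) : 0 <= h a * w i / beta i.
    by rewrite !mulr_ge0 ?invr_ge0 ?beta_ge0 // ltW.
  apply: (convex_le_inv hC h0) => //.
    by apply: sumr_ge0 => i _; apply: mulr_ge0.
  apply: le_trans (jensen_sub hC h0 p0 _ _) _ => //.
    by rewrite (eq_bigr (fun i => h a * (w i / beta i))) -?mulr_sumr // => i _; ring.
  rewrite (eq_bigr (fun i => h a * w i)) => [|i _]; first by rewrite -mulr_sumr w1 mulr1.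
  rewrite ht //; have [/[dup] bz /wz' ->|bi] := eqVneq (beta i) 0; last exact: mulfVK.
  by rewrite bz !mulr0.
have rest : \sum_(i < d | ~~ (i < k)%N) a * w i <=
    \sum_(i < d | ~~ (i < k)%N) h a * w i * (t i / beta i).
  apply: ler_sum => i; rewrite -leqNgt => ki; apply: high.
  by apply: le_lt_trans bi0; apply: beta_nincr; rewrite ltn_ord (leq_trans (ltnW i0k)).
move: all_le; rewrite (bigID (fun i : 'I_d => (i < k)%N)) /=.
by rewrite [leRHS](bigID (fun i : 'I_d => (i < k)%N)) /=; lra.
Qed.

(** Expanding [beta i] over the pieces writes [t i] as the sum of
    [h (a l) * w l i * (t i / beta i)], and each piece is handled by [partial_sum_weight]. If
    [beta i = 0], all its nonnegative summands vanish. *)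
Lemma partial_sum_le (L : finType) (k : nat) (a : L -> R) (w : L -> 'I_d -> R) :
  (forall l, 0 <= a l) -> (forall l, 0 <= h (a l)) -> (forall l i, 0 <= w l i) ->
  (forall l, \sum_i w l i = 1) ->
  (forall l, h (a l) * (\sum_(i < d) w l i / beta i) <= 1) ->
  (forall i : 'I_d, beta i = \sum_l h (a l) * w l i) ->
  \sum_(i < d | (i < k)%N) t i <= \sum_(i < d | (i < k)%N) \sum_l a l * w l i.
Proof.
move=> a0 ha w0 w1 wb bE.
rewrite [leRHS]exchange_big /=.
have -> : \sum_(i < d | (i < k)%N) t i =
    \sum_l \sum_(i < d | (i < k)%N) h (a l) * w l i * (t i / beta i).
  rewrite exchange_big /=; apply: eq_bigr => i _.
  rewrite -mulr_suml -bE; have [bz|bi] := eqVneq (beta i) 0.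
    by rewrite t_eq0 // bz mul0r.
  by rewrite mulrC mulfVK.
apply: ler_sum => l _; apply: partial_sum_weight => // i /eqP.
rewrite bE psumr_eq0 => [/allP/(_ l (mem_index_enum _)) /= /eqP //|l' _].
by rewrite mulr_ge0.
Qed.

End PartialSums.

(** The weights [c] and the indicator of [j < k] have the same total, so a threshold [th] may be
    subtracted from every [mu j]. With [th] the [k]-th largest value, each term of the difference is
    nonnegative. *)
Lemma ky_fan_sum (R : realType) (d : nat) (mu : nat -> R) (c : 'I_d -> R) k :
  (k <= d)%N -> (forall i j, (i <= j < d)%N -> mu j <= mu i) ->
  (forall i, 0 <= c i <= 1) -> \sum_i c i = k%:R ->
  \sum_(j < d) c j * mu j <= \sum_(j < d | (j < k)%N) mu j.
Proof.
move=> kd mud c01 cE.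
have E1 : \sum_(j < d) ((j < k)%N%:R - c j) = 0.
  rewrite big_split /= sumrN cE.
  rewrite -natr_sum (eq_bigr (fun j : 'I_d => if (j < k)%N then 1%N else 0%N)); last first.
    by move=> j _; case: (j < k)%N.
  by rewrite -big_mkcond /= -(big_ord_widen _ (fun=> 1%N) kd) sum1_card card_ord subrr.
rewrite [leRHS]big_mkcond /= -subr_ge0 -sumrB.
pose th := mu k.-1.
have -> : \sum_(j < d) ((if (j < k)%N then mu j else 0) - c j * mu j) =
    \sum_(j < d) ((j < k)%N%:R - c j) * (mu j - th).
  transitivity (\sum_(j < d) ((j < k)%N%:R - c j) * mu j - \sum_(j < d) ((j < k)%N%:R - c j) * th).
    rewrite -mulr_suml E1 mul0r subr0; apply: eq_bigr => j _.
    by rewrite mulrBl; case: (j < k)%N; rewrite ?mul1r ?mul0r.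
  by rewrite -sumrB; apply: eq_bigr => j _; ring.
apply: sumr_ge0 => j _; have /andP[c0 c1] := c01 j; case: ltnP => jk.
  by apply: mulr_ge0; rewrite subr_ge0 //; apply: mud; lia.
(* For [k = 0] the threshold [mu k.-1] is [mu 0], which does not lie above the other values in the
   needed sense; there all weights vanish instead. *)
case: k => [|k] in kd cE E1 th jk *.
  have /eqP : \sum_i c i = 0 by rewrite cE.
  rewrite psumr_eq0 => [/allP/(_ j (mem_index_enum _)) /= /eqP ->|i _].
    by rewrite subrr mul0r.
  by case/andP: (c01 i).
rewrite mulr_le0 ?sub0r ?oppr_le0 // subr_le0; apply: mud; have := ltn_ord j; lia.
Qed.

(** * Horn's theorem for weak majorization *)

Section Horn.
Variable R : rcfType.
Implicit Types (x y w v : nat -> R) (c s : R) (l q n : nat).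

(** [e0] is the vector [(c, s)] in the plane of coordinates [l], [l.+1]. For [c ^+ 2 + s ^+ 2 = 1],
    [spread] below embeds one dimension less isometrically onto its orthogonal complement, sending
    the [l]-th basis vector to [(- s, c)]. *)
Let e0 l c s j := if j == l then c else if j == l.+1 then s else 0.

Let spread l c s w j :=
  if (j < l)%N then w j else
  if j == l then - s * w l else if j == l.+1 then c * w l else w j.-1.

Let merge l (z : R) y j := if (j < l)%N then y j else if j == l then z else y j.+1.

Lemma sum_split3 l q (G : nat -> R) : \sum_(j < l + q.+2) G j =
  \sum_(j < l) G j + (G l + G l.+1 + \sum_(j < q) G (l.+2 + j)%N).
Proof.
rewrite big_split_ord /= !big_ord_recl /= addn0 addn1 -!addrA.
by congr (_ + (_ + (_ + _))); apply: eq_bigr => j _; congr G; rewrite /bump /=; lia.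
Qed.

Lemma sum_split2 l q (G : nat -> R) : \sum_(j < l + q.+1) G j =
  \sum_(j < l) G j + (G l + \sum_(j < q) G (l.+1 + j)%N).
Proof.
rewrite big_split_ord /= big_ord_recl /= addn0.
by congr (_ + (_ + _)); apply: eq_bigr => j _; congr G; rewrite /bump /=; lia.
Qed.

Let e0_sum l q c s (G : nat -> R) :
  \sum_(j < l + q.+2) e0 l c s j * G j = c * G l + s * G l.+1.
Proof.
rewrite (sum_split3 l q (fun j => e0 l c s j * G j)) /e0.
rewrite !big1 => [|j _|j _]; first by rewrite eqxx eqn_leq ltnn eqxx addr0 add0r.
  by do 2 (case: eqP => [|_]; first lia); rewrite mul0r.
have := ltn_ord j; move=> jl.
by do 2 (case: eqP => [|_]; first lia); rewrite mul0r.
Qed.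

(** The compression of [diag y] to the range of [spread] is again diagonal, with entries
    [merge l z y]. For [y] and [z] equal to [1] this says that [spread] preserves inner products. *)
Let spread_sum l q c s z w v y : z = s ^+ 2 * y l + c ^+ 2 * y l.+1 ->
  \sum_(j < l + q.+2) spread l c s w j * spread l c s v j * y j =
  \sum_(j < l + q.+1) w j * v j * merge l z y j.
Proof.
move=> ->; rewrite (sum_split3 l q (fun j => spread l c s w j * spread l c s v j * y j)).
rewrite (sum_split2 l q (fun j => w j * v j * merge l _ y j)) /spread /merge.
rewrite !ltnn !eqxx ltnNge leqnSn /= eqn_leq ltnn /=.
congr (_ + (_ + _)); first by apply: eq_bigr => j _; rewrite ltn_ord.
  by ring.
apply: eq_bigr => j _.
rewrite (_ : (l.+2 + j < l)%N = false); last lia.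
rewrite (_ : (l.+1 + j < l)%N = false); last lia.
rewrite (_ : (l.+2 + j == l)%N = false); last lia.
rewrite (_ : (l.+1 + j == l)%N = false); last lia.
by rewrite (_ : (l.+2 + j == l.+1)%N = false) //; lia.
Qed.

Let merge_nincr l q z y : (forall i j, (i <= j < l + q.+2)%N -> y j <= y i) ->
  y l.+1 <= z <= y l ->
  forall i j, (i <= j < l + q.+1)%N -> merge l z y j <= merge l z y i.
Proof.
move=> yd /andP[z1 z2] i j ij; rewrite /merge.
case: (ltngtP j l) => jl; case: (ltngtP i l) => il; try lia; try by apply: yd; lia.
- by apply: le_trans z1; apply: yd; lia.
- by apply: le_trans z2 _; apply: yd; lia.
- by [].
Qed.

(* A weak form of Horn's theorem. Induction on [n]: rotating two consecutive
   coordinates [l] and [l.+1] with [y l.+1 < x 0 <= y l] puts [x 0] on the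
   diagonal of [diag y] and merges [y l], [y l.+1] into [y l + y l.+1 - x 0]. *)
Lemma weak_horn n x y :
  (forall i j, (i <= j < n)%N -> x j <= x i) ->
  (forall i j, (i <= j < n)%N -> y j <= y i) ->
  (forall k, (k <= n)%N -> \sum_(i < k) x i <= \sum_(i < k) y i) ->
  exists U : nat -> nat -> R,
    (forall i j, (i < n)%N -> (j < n)%N -> \sum_(k < n) U i k * U j k = (i == j)%:R) /\
    (forall i, (i < n)%N -> x i <= \sum_(k < n) U i k ^+ 2 * y k).
Proof.
elim: n x y => [|n IH] x y xd yd xy; first by exists (fun _ _ => 0).
(* If the largest [x] is at most the smallest [y], the identity matrix serves. *)
have [xn|xn] := leP (x 0%N) (y n).
  exists (fun i j => (i == j)%:R); split=> [i j ilt jlt|i ilt].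
    rewrite (bigD1 (Ordinal ilt)) //= eqxx mul1r eq_sym big1 ?addr0 // => k ki.
    by rewrite -val_eqE /= eq_sym in ki; rewrite (negPf ki) mul0r.
  rewrite (bigD1 (Ordinal ilt)) //= eqxx expr1n mul1r big1 ?addr0 => [|k ki].
    by apply: (le_trans (xd 0%N i _)) => //; apply: (le_trans xn); apply: yd; lia.
  by rewrite -val_eqE /= eq_sym in ki; rewrite (negPf ki) expr0n mul0r.
have x0y0 : x 0%N <= y 0%N by have := xy 1%N isT; rewrite !big_ord1.
have exl : exists l, y l.+1 < x 0%N.
  by case: n xn {IH xd yd xy} => [|n] xn; [move: xn; rewrite ltNge x0y0 | exists n].
case: (ex_minnP exl) => l yl lmin.
have {exl} ln : (l < n)%N.
  case: n xn {IH xd yd xy} => [|n] xn; first by move: xn; rewrite ltNge x0y0.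
  by rewrite ltnS lmin.
have xyl : x 0%N <= y l.
  by case: l yl lmin ln => // l _ lmin _; rewrite leNgt; apply/negP => /lmin; rewrite ltnn.
have [q En] : exists q, n = (l + q.+1)%N by exists (n - l.+1)%N; lia.
have {ln} En1 : n.+1 = (l + q.+2)%N by lia.
have dpos : 0 < y l - y l.+1 by lra.
have A0 : 0 <= (x 0%N - y l.+1) / (y l - y l.+1) by rewrite divr_ge0; lra.
have B0 : 0 <= (y l - x 0%N) / (y l - y l.+1) by rewrite divr_ge0; lra.
(* The cosine and sine that solve [c ^+ 2 * y l + s ^+ 2 * y l.+1 = x 0]. *)
pose c := Num.sqrt ((x 0%N - y l.+1) / (y l - y l.+1)).
pose s := Num.sqrt ((y l - x 0%N) / (y l - y l.+1)).
have c2 : c ^+ 2 = (x 0%N - y l.+1) / (y l - y l.+1) by rewrite sqr_sqrtr.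
have s2 : s ^+ 2 = (y l - x 0%N) / (y l - y l.+1) by rewrite sqr_sqrtr.
have dn0 : y l - y l.+1 != 0 by rewrite gt_eqF.
have cs1 : c ^+ 2 + s ^+ 2 = 1 by rewrite c2 s2; field.
have cx : c ^+ 2 * y l + s ^+ 2 * y l.+1 = x 0%N by rewrite c2 s2; field.
pose z := y l + y l.+1 - x 0%N.
have zE : z = s ^+ 2 * y l + c ^+ 2 * y l.+1.
  by rewrite /z -cx (_ : s ^+ 2 = 1 - c ^+ 2); [ring | lra].
have [||| U [Uo Ux]] := IH (fun i => x i.+1) (merge l z y).
- by move=> i j ij; apply: xd; lia.
- rewrite En; apply: merge_nincr; first by rewrite -En1.
  by rewrite /z; apply/andP; split; lra.
(* Up to [l], the comparison is termwise through [x 0 <= y l]. Past [l], the merged sum is the sum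
   of [k.+1] entries of [y] minus [x 0]. *)
- move=> k kn; have [kl|lk] := leqP k l.
    apply: ler_sum => i _; rewrite /merge.
    have ik := ltn_ord i; rewrite (leq_trans ik kl).
    apply: (le_trans (xd 0%N i.+1 _)); first by lia.
    by apply: (le_trans xyl); apply: yd; lia.
  have [r Ek] : exists r, k = (l + r.+1)%N by exists (k - l.+1)%N; lia.
  have := xy k.+1 kn; rewrite big_ord_recl.
  have -> : \sum_(i < k.+1) y i = x 0%N + \sum_(i < k) merge l z y i.
    have Ek1 : k.+1 = (l + r.+2)%N by lia.
    rewrite Ek1 (sum_split3 l r y) Ek (sum_split2 l r (merge l z y)) /merge ltnn eqxx.
    rewrite (_ : \sum_(j < l) (if _ then _ else _) = \sum_(j < l) y j); last first.
      by apply: eq_bigr => j _; rewrite ltn_ord.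
    rewrite (_ : \sum_(j < r) (if _ then _ else _) = \sum_(j < r) y (l.+2 + j)%N); last first.
      apply: eq_bigr => j _; rewrite (_ : (l.+1 + j < l)%N = false); last lia.
      by rewrite (_ : (l.+1 + j == l)%N = false); last lia.
    by rewrite /z; lra.
  by rewrite lerD2l.
pose V i := if i is i'.+1 then spread l c s (U i') else e0 l c s.
have spread0 i : c * spread l c s (U i) l + s * spread l c s (U i) l.+1 = 0.
  by rewrite /spread ltnn eqxx ltnNge leqnSn /= eqn_leq ltnn eqxx /=; ring.
exists V; split.
  have e0V j : (j < n.+1)%N -> \sum_(k < n.+1) V 0%N k * V j k = (0%N == j)%:R.
    case: j => [|j] _ /=; rewrite En1 e0_sum ?spread0 //.
    by rewrite /e0 eqxx eqn_leq ltnn eqxx -cs1 !expr2.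
  case=> [|i] j ilt jlt; first exact: e0V.
  case: j jlt => [|j] jlt.
    by rewrite (eq_bigr (fun k : 'I_n.+1 => V 0%N k * V i.+1 k)) ?e0V // => k _; rewrite mulrC.
  rewrite eqSS -(Uo i j) // En1 En /=.
  have z1 : 1 = s ^+ 2 * 1 + c ^+ 2 * 1 by lra.
  have := @spread_sum l q c s 1 (U i) (U j) (fun=> 1) z1.
  rewrite (eq_bigr (fun k : 'I_(l + q.+2) =>
    spread l c s (U i) k * spread l c s (U j) k)); last first.
    by move=> k _; rewrite mulr1.
  move=> ->; apply: eq_bigr => k _; by rewrite /merge !if_same mulr1.
case=> [|i] ilt.
  rewrite En1 (eq_bigr (fun k : 'I_(l + q.+2) => e0 l c s k * (e0 l c s k * y k))); last first.
    by move=> k _; rewrite expr2 mulrA.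
  rewrite (e0_sum l q c s (fun k => e0 l c s k * y k)) /e0 eqxx eqn_leq ltnn eqxx /=.
  by rewrite !mulrA -!expr2 cx.
apply: (le_trans (Ux i ilt)); rewrite En1 En.
rewrite [leRHS](eq_bigr (fun k : 'I_(l + q.+2) =>
  spread l c s (U i) k * spread l c s (U i) k * y k)); last first.
  by move=> k _; rewrite expr2.
by rewrite (@spread_sum l q c s z _ _ y zE); apply: ler_sum => k _; rewrite expr2.
Qed.

End Horn.

(** * Roots of unity and the diagonal part as an average *)

Section UnitaryMatrices.
Variable C : numClosedFieldType.

Lemma trmxC_mul m n p (A : 'M[C]_(m, n)) (B : 'M[C]_(n, p)) :
  (A *m B)^t* = B^t* *m A^t*.
Proof. by rewrite trmx_mul map_mxM. Qed.

Lemma unitary_trmxC d (U : 'M[C]_d) :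
  U \is unitarymx -> U^t* \is unitarymx.
Proof. by rewrite trmxC_unitary. Qed.

Lemma unitary_conj_comp d (E W O D F : 'M[C]_d) :
  F \is unitarymx ->
  E^t* *m (W *m (O *m F)) *m (F^t* *m D *m F) *m (E^t* *m (W *m (O *m F)))^t* =
    E^t* *m (W *m (O *m D *m O^t*) *m W^t*) *m E.
Proof.
by move=> Fu; rewrite !trmxC_mul trmxCK !mulmxA !(mulmxtVK _ Fu).
Qed.

Lemma prim_root_exists n : (0 < n)%N -> exists w : C, n.-primitive_root w.
Proof.
pose q : {poly C} := 'X^n - 1; have [r Dq] := closed_field_poly_normal q.
move=> n_gt0; rewrite (monicP _) ?monicXnsubC // scale1r in Dq.
have rn1 : all n.-unity_root r by apply/allP=> w; rewrite -root_prod_XsubC -Dq.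
have sz_r : (n < (size r).+1)%N by rewrite -(size_prod_XsubC r id) -Dq size_XnsubC.
have [|w] := hasP (has_prim_root n_gt0 rn1 _ sz_r); last by exists w.
by rewrite -separable_prod_XsubC -Dq separable_Xn_sub_1 // pnatr_eq0 -lt0n.
Qed.

Lemma unity_root_conj n (w : C) : (0 < n)%N -> w ^+ n = 1 -> w * Num.conj w = 1.
Proof.
move=> n0 wn; rewrite -normCK; suff -> : `|w| = 1 by rewrite expr1n.
by apply/eqP; rewrite -(@pexpr_eq1 _ _ n) // -normrX wn normr1.
Qed.

(** A geometric sum with ratio [u], an [n]-th root of unity that equals [1] only if [i = j]. *)
Lemma prim_root_orthogonal n (w : C) (i j : 'I_n) : n.-primitive_root w ->
  \sum_(k < n) w ^+ (k * i) * Num.conj (w ^+ (k * j)) = (n%:R *+ (i == j)).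
Proof.
move=> wp; have n0 := prim_order_gt0 wp.
have wc := unity_root_conj n0 (prim_expr_order wp).
pose u := w ^+ i * Num.conj (w ^+ j).
rewrite (eq_bigr (fun k : 'I_n => u ^+ k)) => [|k _]; last first.
  by rewrite /u exprMn -rmorphXn /= -!exprM mulnC (mulnC j).
have un : u ^+ n = 1.
  rewrite /u exprMn -rmorphXn /= -!exprM (mulnC i) (mulnC j) !exprM.
  by rewrite !(prim_expr_order wp) !expr1n rmorph1 mulr1.
have [eij|ij] := eqVneq i j.
  rewrite (eq_bigr (fun=> 1)) => [|k _]; last first.
    by rewrite /u eij rmorphXn /= -exprMn wc !expr1n.
  by rewrite sumr_const card_ord.
have : (u - 1) * (\sum_(k < n) u ^+ k) = 0 by rewrite -subrX1 un subrr.
move/eqP; rewrite mulf_eq0 => /orP[/eqP u1|/eqP //].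
case/eqP: ij; apply: val_inj => /=.
have : w ^+ i == w ^+ j.
  move/eqP: u1; rewrite subr_eq0 => /eqP u1.
  by rewrite -[w ^+ j]mul1r -u1 /u -mulrA [_ * w ^+ j]mulrC rmorphXn /= -exprMn wc expr1n mulr1.
by rewrite (eq_prim_root_expr wp) !modn_small // => /eqP.
Qed.

(** Conjugation by the diagonal matrix of the [w ^+ (k * j)] multiplies the entry [i], [j] by a
    character value in [k]; averaging over [k] kills the off-diagonal entries. *)
Lemma pinching d (Z : 'M[C]_d) : (0 < d)%N ->
  exists W : 'I_d -> 'M[C]_d, (forall k, W k \is unitarymx) /\
    d%:R^-1 *: \sum_k (W k *m Z *m (W k)^t*) = diag_mx (\row_j Z j j).
Proof.
move=> d0; have [w wp] := prim_root_exists d0.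
pose W (k : 'I_d) : 'M[C]_d := diag_mx (\row_j w ^+ (k * j)).
have WC k : (W k)^t* = diag_mx (\row_j Num.conj (w ^+ (k * j))).
  rewrite tr_diag_mx map_diag_mx; congr diag_mx.
  by apply/rowP=> j; rewrite !mxE.
have d_neq0 : d%:R != 0 :> C by rewrite pnatr_eq0 -lt0n.
exists W; split=> [k|].
  apply/unitarymxP; rewrite WC mulmx_diag -diag_const_mx; congr diag_mx.
  apply/rowP=> j; rewrite !mxE rmorphXn /= -exprMn.
  by rewrite (unity_root_conj d0 (prim_expr_order wp)) expr1n.
apply/matrixP=> i j; rewrite !mxE summxE.
rewrite (eq_bigr (fun k : 'I_d => Z i j * (w ^+ (k * i) * Num.conj (w ^+ (k * j))))).
  rewrite -mulr_sumr prim_root_orthogonal //; have [->|ij] := eqVneq i j.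
    by rewrite !mulr1n mulrC mulfK.
  by rewrite !mulr0n !mulr0.
move=> k _; rewrite WC mul_mx_diag mul_diag_mx !mxE.
by rewrite [w ^+ _ * _]mulrC mulrA.
Qed.

End UnitaryMatrices.

(** * Hermitian matrices through sorted diagonalizations *)

Section ComplexMatrices.
Variable R : rcfType.
Implicit Types (d : nat) (z : R[i]) (D : nat -> R).

Definition sqmod z : R := complex.Re z ^+ 2 + complex.Im z ^+ 2.

Lemma sqmodE z : (sqmod z)%:C = z * Num.conj z.
Proof. by rewrite /sqmod add_Re2_Im2 normCK. Qed.

Lemma sqmod_ge0 z : 0 <= sqmod z.
Proof. by rewrite addr_ge0 // sqr_ge0. Qed.

Lemma sqmod_real (x : R) : sqmod x%:C = x ^+ 2.
Proof. by rewrite /sqmod /= expr0n addr0. Qed.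

Lemma sqmodM z z' : sqmod (z * z') = sqmod z * sqmod z'.
Proof. by apply: complexI; rewrite rmorphM /= !sqmodE rmorphM mulrACA. Qed.

Lemma sqmodJ z : sqmod (Num.conj z) = sqmod z.
Proof. by apply: complexI; rewrite !sqmodE conjCK mulrC. Qed.

(** Eigenvalues are indexed by [nat], with only the values below [d] relevant, so that truncated
    sums and [weak_horn] apply directly. *)
Definition cdiag d D : 'M[R[i]]_d := diag_mx (\row_j (D j)%:C).

Definition conjdiag d (U : 'M[R[i]]_d) D := U^t* *m cdiag d D *m U.

Lemma conjC_real_complex (x : R) : Num.conj x%:C = x%:C.
Proof. exact: conjc_real. Qed.

Lemma cdiag_trmxC d D : (cdiag d D)^t* = cdiag d D.
Proof.
rewrite /cdiag tr_diag_mx map_diag_mx; congr diag_mx.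
by apply/rowP=> j; rewrite !mxE; exact: conjC_real_complex.
Qed.

Lemma conjdiag_herm d (U : 'M[R[i]]_d) D : conjdiag U D \is hermsymmx.
Proof.
apply/is_hermitianmxP; rewrite expr0 scale1r.
by rewrite /conjdiag !trmxC_mul trmxCK cdiag_trmxC mulmxA.
Qed.

Lemma herm_sum d I (r : seq I) (A : I -> 'M[R[i]]_d) :
  (forall i, A i \is hermsymmx) -> \sum_(i <- r) A i \is hermsymmx.
Proof.
move=> Ah; apply/is_hermitianmxP; rewrite expr0 scale1r.
elim/big_rec: _ => [|i x _ xE]; first by rewrite trmx0 map_mx0.
rewrite linearD /= map_mxD -xE; congr (_ + _).
by have /is_hermitianmxP := Ah i; rewrite expr0 scale1r.
Qed.

Lemma conjdiag_qform d (U : 'M[R[i]]_d) D (v : 'cV[R[i]]_d) :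
  (v^t* *m conjdiag U D *m v) 0 0 = (\sum_(j < d) D j * sqmod ((U *m v) j 0))%:C.
Proof.
rewrite /conjdiag !mulmxA -trmxC_mul -mulmxA -(trmxCK U) trmxCK.
rewrite mul_mx_diag mxE rmorph_sum; apply: eq_bigr => j _.
by rewrite rmorphM /= sqmodE !mxE mulrAC mulrC [X in _ * X = _]mulrC.
Qed.

Lemma mxfun_conjdiag d f (U : 'M[R[i]]_d) D : U \is unitarymx ->
  mxfun f (conjdiag U D) = conjdiag U (f \o D).
Proof.
move=> Uu; have := mxfun_diag f (\row_j D j) Uu.
have mE (D' : nat -> R) : map_mx (fun x => x%:C) (\row_(j < d) D' j) = \row_j (D' j)%:C.
  by apply/rowP=> j; rewrite !mxE.
rewrite mE -/(cdiag d D) -/(conjdiag U D) => ->; rewrite /conjdiag /cdiag.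
rewrite (_ : map_mx _ _ = \row_(j < d) ((f \o D) j)%:C) //.
by apply/rowP=> j; rewrite !mxE.
Qed.

Lemma conjdiag_psd d (U : 'M[R[i]]_d) D :
  (forall j, (j < d)%N -> 0 <= D j) -> psdmx (conjdiag U D).
Proof.
move=> D0; split=> [|v]; first exact: conjdiag_herm.
rewrite conjdiag_qform ler0c; apply: sumr_ge0 => j _.
by rewrite mulr_ge0 ?D0 ?sqmod_ge0.
Qed.

Lemma conjdiagB d (U : 'M[R[i]]_d) D D' :
  conjdiag U D - conjdiag U D' = conjdiag U (fun j => D j - D' j).
Proof.
rewrite /conjdiag -mulmxBl -mulmxBr.
suff -> : cdiag d D - cdiag d D' = cdiag d (fun j => D j - D' j) by [].
rewrite /cdiag -raddfB; congr diag_mx.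
by apply/rowP=> j; rewrite !mxE rmorphB.
Qed.

Lemma unitary_row_sum d (U : 'M[R[i]]_d) i :
  U \is unitarymx -> \sum_j sqmod (U i j) = 1.
Proof.
move=> /unitarymxP /matrixP /(_ i i); rewrite !mxE eqxx => E.
apply: complexI; rewrite rmorph_sum -[RHS]E; apply: eq_bigr => j _.
by rewrite /= sqmodE !mxE.
Qed.

Lemma unitary_col_sum d (U : 'M[R[i]]_d) j :
  U \is unitarymx -> \sum_i sqmod (U i j) = 1.
Proof.
rewrite -trmx_unitary => /(unitary_row_sum j) <-.
by apply: eq_bigr => i _; rewrite mxE.
Qed.

Lemma conjdiag_eigen_ge0 d (U : 'M[R[i]]_d) D : U \is unitarymx ->
  psdmx (conjdiag U D) -> forall j, (j < d)%N -> 0 <= D j.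
Proof.
move=> /unitarymxP UU [_ psd] j jd.
have := psd (U^t* *m delta_mx (Ordinal jd) 0).
rewrite conjdiag_qform mulmxA UU mul1mx ler0c (bigD1 (Ordinal jd)) //=.
rewrite big1 => [|i ij]; last by rewrite !mxE (negPf ij) /sqmod /= expr0n addr0 mulr0.
by rewrite !mxE !eqxx /sqmod /= expr1n expr0n !addr0 mulr1.
Qed.

Lemma spectral_sorted d (A : 'M[R[i]]_d) : A \is hermsymmx ->
  exists U D, [/\ U \is unitarymx, A = conjdiag U D &
    forall i j, (i <= j < d)%N -> D j <= D i].
Proof.
move=> Ah; have /mxOverP Dr := hermitian_spectral_diag_real Ah.
have /orthomx_spectralP AE := hermitian_normalmx Ah.
have Pu := spectral_unitarymx A.
set P := spectralmx A in AE Pu; set S := spectral_diag A in AE Dr.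
pose t := [tuple complex.Re (S 0 j) | j < d].
(* The sorting permutation [p] is absorbed into the unitary as [perm_mx p]. *)
have /tuple_permP[p pE] : perm_eq (sort >=%O t) t by rewrite perm_sort.
pose D := nth 0 (sort >=%O t).
have Dp (j : 'I_d) : D j = complex.Re (S 0 (p j)).
  have -> : D j = tnth [tuple tnth t (p i) | i < d] j by rewrite (tnth_nth 0) -pE.
  by rewrite !tnth_mktuple.
have pu : (perm_mx p : 'M[R[i]]_d) \is unitarymx.
  apply/unitarymxP; rewrite tr_perm_mx map_perm_mx -perm_mxM.
  by rewrite mulgV perm_mx1.
rewrite (invmx_unitary Pu) in AE.
exists (perm_mx p *m P), D; split.
- exact: mul_unitarymx pu Pu.
- rewrite AE /conjdiag trmxC_mul -!mulmxA; congr (_ *m _).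
  rewrite !mulmxA; congr (_ *m _); rewrite tr_perm_mx map_perm_mx.
  rewrite -row_permE -[in perm_mx p](invgK p) -col_permE.
  apply/matrixP=> i j; rewrite !mxE (inj_eq perm_inj) Dp permKV RRe_real ?Dr //.
have Dsorted : sorted >=%O (sort >=%O t) := sort_sorted ge_total t.
move=> i j /andP[ij jd].
apply: (sorted_leq_nth ge_trans ge_refl 0 Dsorted _ _ _ _ ij);
  by rewrite inE size_sort size_tuple // (leq_ltn_trans ij).
Qed.

End ComplexMatrices.

(** * Averages of conjugates, and quadratic forms of sums *)

Lemma real_orthogonal_unitary (R : rcfType) d (U : nat -> nat -> R) :
  (forall i j, (i < d)%N -> (j < d)%N -> \sum_(k < d) U i k * U j k = (i == j)%:R) ->
  (\matrix_(i < d, j < d) (U i j)%:C) \is unitarymx.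
Proof.
move=> Uo; apply/unitarymxP/matrixP=> i j; rewrite !mxE -val_eqE /=.
transitivity ((\sum_(k < d) U i k * U j k)%:C).
  rewrite rmorph_sum; apply: eq_bigr => k _; rewrite !mxE rmorphM /=.
  by congr (_ * _); exact: conjC_real_complex.
by rewrite Uo // rmorph_nat.
Qed.

(** The unitaries [E^t* *m W k *m O *m F] pass from the eigenbasis given by [F] to that given by
    [E]. Between the two, [pinching] retains the diagonal of [O *m cdiag d D *m O^t*]. *)
Lemma average_conjdiag (R : rcfType) d (E F : 'M[R[i]]_d) (U : nat -> nat -> R)
    (D : nat -> R) : (0 < d)%N -> E \is unitarymx -> F \is unitarymx ->
  (forall i j, (i < d)%N -> (j < d)%N -> \sum_(k < d) U i k * U j k = (i == j)%:R) ->
  exists V : 'I_d -> 'M[R[i]]_d, (forall k, V k \is unitarymx) /\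
    d%:R^-1 *: \sum_k (V k *m conjdiag F D *m (V k)^t*) =
      conjdiag E (fun i => \sum_(j < d) U i j ^+ 2 * D j).
Proof.
move=> d0 Eu Fu /real_orthogonal_unitary.
set O := (X in X \is _) => Ou.
pose Z := O *m cdiag d D *m O^t*.
have [W [Wu WZ]] := pinching Z d0.
exists (fun k => E^t* *m (W k *m (O *m F))); split=> [k|].
  exact: mul_unitarymx (unitary_trmxC Eu) (mul_unitarymx (Wu k) (mul_unitarymx Ou Fu)).
rewrite (eq_bigr _ (fun k _ => unitary_conj_comp E (W k) O (cdiag d D) Fu)).
rewrite -mulmx_suml -mulmx_sumr scalemxAl scalemxAr WZ /conjdiag.
suff -> : \row_j Z j j = \row_(j < d) (\sum_(k < d) U j k ^+ 2 * D k)%:C by [].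
apply/rowP=> i; rewrite !mxE rmorph_sum; apply: eq_bigr => j _.
rewrite mul_mx_diag !mxE rmorphM rmorphXn expr2 /=.
by rewrite mulrAC; congr (_ * _ * _); exact: conjC_real_complex.
Qed.

Lemma nneg_convex_comp (R : realType) (g h : R -> R) :
  nneg_convex g -> nneg_convex h ->
  {in `[0, +oo[ &, {homo g : x y / x <= y}} -> (forall x, 0 <= x -> 0 <= h x) ->
  nneg_convex (g \o h).
Proof.
move=> gC hC gm h_ge0 x y t x0 y0 /[dup] t01 /andP[t0 t1] /=.
apply: le_trans (gC _ _ _ (h_ge0 _ x0) (h_ge0 _ y0) t01).
apply: (nneg_ndecr gm); last exact: hC.
by apply: h_ge0; rewrite addr_ge0 // mulr_ge0 // subr_ge0.
Qed.

(** Both quadratic forms are evaluated at [E^t* *m v], whose coordinates in the eigenbasis of the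
    sum are those of [v]. *)
Lemma conjdiag_sum_qform (R : rcfType) (m d : nat) (E : 'M[R[i]]_d) (D : nat -> R)
    (U : 'I_m -> 'M[R[i]]_d) (D' : 'I_m -> nat -> R) : E \is unitarymx ->
  \sum_k conjdiag (U k) (D' k) = conjdiag E D -> forall v : 'cV[R[i]]_d,
  \sum_(i < d) D i * sqmod (v i 0) =
    \sum_k \sum_(j < d) D' k j * sqmod ((U k *m E^t* *m v) j 0).
Proof.
move=> /unitarymxP EE sE v; apply: complexI.
have := conjdiag_qform E D (E^t* *m v).
rewrite (mulmxA E) EE mul1mx => <-; rewrite -sE mulmx_sumr mulmx_suml summxE.
rewrite rmorph_sum; apply: eq_bigr => k _.
by rewrite conjdiag_qform (mulmxA (U k)).
Qed.

Lemma sqmod_mul_delta (R : rcfType) d (M : 'M[R[i]]_d) i j :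
  sqmod ((M *m delta_mx i (0 : 'I_1)) j 0) = sqmod (M j i).
Proof. by rewrite -colE mxE. Qed.

Lemma sum_sqmod_delta (R : rcfType) d (D : nat -> R) (i : 'I_d) :
  \sum_(j < d) D j * sqmod ((delta_mx i 0 : 'cV[R[i]]_d) j 0) = D i.
Proof.
rewrite (bigD1 i) //= !mxE !eqxx /= big1 => [|j ji].
  by rewrite /sqmod /= expr1n expr0n !addr0 mulr1.
by rewrite mxE (negPf ji) /= /sqmod /= expr0n addr0 mulr0.
Qed.

(** * Weak majorization of [t] by [mu], and the operator inequality *)

Theorem theorem2p1 (R : realType) (d m : nat) (d_ge1 : (1 <= d)%N)
    (m_ge1 : (1 <= m)%N) (g h : R -> R)
    (g_ndecr : {in `[0, +oo[ &, {homo g : x y / x <= y}})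
    (g_convex : @convex_function R R^o [set x : R | 0 <= x]%classic g)
    (h_ndecr : {in `[0, +oo[ &, {homo h : x y / x <= y}})
    (h_convex : @convex_function R R^o [set x : R | 0 <= x]%classic h)
    (h0 : h 0 = 0)
    (A : 'I_m -> 'M[R[i]]_d) (A_psd : forall k, psdmx (A k)) :
  exists V : 'I_d -> 'M[R[i]]_d,
    (forall i, V i \is unitarymx) /\
    loewner_le (mxfun g (\sum_(k < m) mxfun h (A k)))
      (d%:R^-1 *: \sum_(i < d) (V i *m mxfun (g \o h) (\sum_(k < m) A k)
                                  *m (V i)^t*)).
Proof.
have {}g_convex := convex_function_nneg g_convex.
have {}h_convex := convex_function_nneg h_convex.
have h_ge0 x : 0 <= x -> 0 <= h x by rewrite -{2}h0; exact: nneg_ndecr.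
have gh_convex := nneg_convex_comp g_convex h_convex g_ndecr h_ge0.
have /choice[UD UDP] k : exists UD : 'M[R[i]]_d * (nat -> R),
    UD.1 \is unitarymx /\ A k = conjdiag UD.1 UD.2.
  by have [U [D [? ? _]]] := spectral_sorted (A_psd k).1; exists (U, D).
pose U k := (UD k).1; pose a k := (UD k).2.
have Uu k : U k \is unitarymx := (UDP k).1.
have AE k : A k = conjdiag (U k) (a k) := (UDP k).2.
have a_ge0 k j : (j < d)%N -> 0 <= a k j.
  by apply: (conjdiag_eigen_ge0 (Uu k)); rewrite -AE.
have [F [mu [Fu SE mu_nincr]]] : exists F mu, [/\ F \is unitarymx,
    \sum_k A k = conjdiag F mu & forall i j, (i <= j < d)%N -> mu j <= mu i].
  by apply/spectral_sorted/herm_sum => k; case: (A_psd k).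
have [E [beta [Eu BE beta_nincr]]] : exists E beta, [/\ E \is unitarymx,
    \sum_k mxfun h (A k) = conjdiag E beta & forall i j, (i <= j < d)%N -> beta j <= beta i].
  apply/spectral_sorted/herm_sum => k; rewrite AE (mxfun_conjdiag h (a k) (Uu k)).
  exact: conjdiag_herm.
rewrite BE SE (mxfun_conjdiag g beta Eu) (mxfun_conjdiag (g \o h) mu Fu).
have {}BE : \sum_k conjdiag (U k) (h \o a k) = conjdiag E beta.
  by rewrite -BE; apply: eq_bigr => k _; rewrite AE (mxfun_conjdiag h (a k) (Uu k)).
have {}SE : \sum_k conjdiag (U k) (a k) = conjdiag F mu.
  by rewrite -SE; apply: eq_bigr => k _; rewrite AE.
have [M ME] : exists M : 'I_m -> 'M[R[i]]_d, forall k, M k = U k *m E^t*.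
  by exists (fun k => U k *m E^t*).
have Mu k : M k \is unitarymx.
  by rewrite ME; exact: mul_unitarymx (Uu k) (unitary_trmxC Eu).
have qB (v : 'cV[R[i]]_d) : \sum_(i < d) beta i * sqmod (v i 0) =
    \sum_k \sum_(j < d) h (a k j) * sqmod ((M k *m v) j 0).
  rewrite (conjdiag_sum_qform Eu BE).
  by apply: eq_bigr => k _; apply: eq_bigr => j _; rewrite ME.
(* A pair [l] stands for the rank-one piece of [A l.1] at its eigenvector number [l.2]. *)
pose w (l : 'I_m * 'I_d) (i : 'I_d) := sqmod (M l.1 l.2 i).
have w_ge0 l i : 0 <= w l i by exact: sqmod_ge0.
have w1 l : \sum_i w l i = 1 by exact: unitary_row_sum (Mu l.1).
pose al (l : 'I_m * 'I_d) := a l.1 l.2.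
have al_ge0 l : 0 <= al l by exact: a_ge0.
have betaE (i : 'I_d) : beta i = \sum_l h (al l) * w l i.
  rewrite -(sum_sqmod_delta beta i) qB pair_bigA /=.
  by apply: eq_bigr => l _; rewrite sqmod_mul_delta.
have beta_ge0 i : (i < d)%N -> 0 <= beta i.
  move=> id; rewrite (betaE (Ordinal id)); apply: sumr_ge0 => l _.
  by rewrite mulr_ge0 // h_ge0.
have wb l : h (al l) * (\sum_(i < d) w l i / beta i) <= 1.
  set th := \sum_(i < d) _.
  have th_ge0 : 0 <= th.
    by apply: sumr_ge0 => i _; rewrite divr_ge0 // beta_ge0.
  have : h (al l) * th ^+ 2 <= th.
    (* The eigenvector of piece [l] after applying the inverse of [B], zero where [beta i = 0]. The
       form of [B] at [v] is [th], and piece [l] alone contributes [h (al l) * th ^+ 2]. *)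
    pose v : 'cV[R[i]]_d := \col_i (Num.conj (M l.1 l.2 i) * (beta i)^-1%:C).
    have vE : (M l.1 *m v) l.2 0 = th%:C.
      rewrite mxE rmorph_sum; apply: eq_bigr => i _.
      by rewrite mxE mulrA -sqmodE -rmorphM.
    have thE : th = \sum_(i < d) beta i * sqmod (v i 0).
      apply: eq_bigr => i _; rewrite mxE sqmodM sqmodJ sqmod_real -/(w l i).
      have [->|bi] := eqVneq (beta i) 0; first by rewrite invr0 !mulr0 mul0r.
      by field.
    rewrite [leRHS]thE qB pair_bigA /= (bigD1 l) //= vE sqmod_real lerDl.
    apply: sumr_ge0 => l' _; rewrite mulr_ge0 ?sqmod_ge0 //.
    exact/h_ge0/al_ge0.
  have [->|th0] := eqVneq th 0; first by rewrite mulr0.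
  by rewrite expr2 mulrA ger_pMl // lt0r th0.
have /choice[t tP] i : exists t, [/\ 0 <= t, (i < d)%N -> h t = beta i &
    (i < d)%N -> beta i = 0 -> t = 0].
  case: (ltnP i d) => [id|_]; last by exists 0.
  have [bi|bi] := eqVneq (beta i) 0; first by exists 0; rewrite h0 bi.
  (* The positive value of [h] that [nneg_convex_surj] requires comes from a piece contributing to
     [beta i]. *)
  have [l hl] : exists l, 0 < h (al l).
    apply/not_existsP => H; case/eqP: bi; rewrite (betaE (Ordinal id)).
    apply: big1 => l _; have := H l; move/negP; rewrite -leNgt => hl.
    have -> : h (al l) = 0 by apply/eqP; rewrite eq_le hl h_ge0.
    by rewrite mul0r.
  have [t t0 ht] := nneg_convex_surj h_convex h0 h_ndecr (al_ge0 l) hl (beta_ge0 _ id).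
  by exists t; split=> // _ bz; rewrite bz eqxx in bi.
have t_ge0 i : 0 <= t i by case: (tP i).
have ht i : (i < d)%N -> h (t i) = beta i by case: (tP i).
have t_eq0 i : (i < d)%N -> beta i = 0 -> t i = 0 by case: (tP i).
have t_nincr i j : (i <= j < d)%N -> t j <= t i.
  move=> /[dup] ijd /andP[ij jd]; have id := leq_ltn_trans ij jd.
  have [bj|bj] := eqVneq (beta j) 0; first by rewrite t_eq0.
  have b_ij := beta_nincr _ _ ijd.
  apply: (convex_le_inv h_convex h0) => //; rewrite !ht //.
  by apply: lt_le_trans b_ij; rewrite lt0r bj beta_ge0.
have t_mu k : (k <= d)%N -> \sum_(i < k) t i <= \sum_(i < k) mu i.
  move=> kd; rewrite !(big_ord_widen d) //.
  apply: le_trans (partial_sum_le h_convex h0 beta_nincr beta_ge0 t_ge0 ht t_eq0 k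
    al_ge0 (fun l => h_ge0 _ (al_ge0 l)) w_ge0 w1 wb betaE) _.
  (* [N] relates the two eigenbases. The sums of [sqmod (N j i)] over [i < k] are the weights for
     [ky_fan_sum]: at most [1] by the rows, of total [k] by the columns. *)
  have [N NE] : exists N, N = F *m E^t* by exists (F *m E^t*).
  have Nu : N \is unitarymx.
    by rewrite NE; exact: mul_unitarymx Fu (unitary_trmxC Eu).
  have -> : \sum_(i < d | (i < k)%N) \sum_l al l * w l i =
      \sum_(j < d) (\sum_(i < d | (i < k)%N) sqmod (N j i)) * mu j.
    rewrite (eq_bigr (fun i => \sum_(j < d) sqmod (N j i) * mu j)).
      by rewrite exchange_big /=; apply: eq_bigr => j _; rewrite mulr_suml.
    move=> i _; pose e : 'cV[R[i]]_d := delta_mx i 0.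
    have Ne k' : U k' *m F^t* *m (N *m e) = M k' *m e.
      by rewrite NE ME !mulmxA (mulmxKtV _ Fu).
    have := conjdiag_sum_qform Fu SE (N *m e); rewrite pair_bigA /=.
    rewrite (eq_bigr (fun j => sqmod (N j i) * mu j)) => [->|j _]; last first.
      by rewrite sqmod_mul_delta mulrC.
    by apply: eq_bigr => l _; rewrite Ne sqmod_mul_delta.
  apply: ky_fan_sum => //.
    move=> j; rewrite sumr_ge0 => [/=|i _]; last exact: sqmod_ge0.
    rewrite -(unitary_row_sum j Nu) [leRHS](bigID (fun i : 'I_d => (i < k)%N)) /=.
    by rewrite lerDl sumr_ge0 // => i _; exact: sqmod_ge0.
  rewrite exchange_big /= (eq_bigr (fun=> 1)) => [|i _]; last exact: unitary_col_sum i Nu.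
  by rewrite -(big_ord_widen _ (fun=> 1) kd) sumr_const card_ord.
have [O [Oo Ot]] := weak_horn t_nincr mu_nincr t_mu.
have [V [Vu VE]] := average_conjdiag ((g \o h) \o mu) d_ge1 Eu Fu Oo.
exists V; split=> //; rewrite VE /loewner_le conjdiagB.
(* Both sides are diagonal in the eigenbasis given by [E], so the scalar inequality between
   [g (h (t j))] and the average of the [g (h (mu k))] with weights [O j k ^+ 2] remains. *)
apply: conjdiag_psd => j jd; rewrite subr_ge0 /= -ht //.
have mu_ge0 i : (i < d)%N -> 0 <= mu i.
  apply: (conjdiag_eigen_ge0 Fu); rewrite -SE; split.
    by apply: herm_sum => k; exact: conjdiag_herm.
  move=> v; rewrite mulmx_sumr mulmx_suml summxE; apply: sumr_ge0 => k _.
  by have [_] := conjdiag_psd (U k) (a_ge0 k); exact.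
have O1 : \sum_(k < d) O j k ^+ 2 = 1.
  by rewrite (eq_bigr _ (fun _ _ => expr2 _)) Oo // eqxx.
apply: le_trans (jensen gh_convex _ _ O1); last 2 first.
- by move=> k; exact: sqr_ge0.
- by move=> k; exact: mu_ge0.
apply: (nneg_ndecr g_ndecr); first exact: h_ge0.
by apply: (nneg_ndecr h_ndecr); rewrite // Ot.
Qed.
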